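(* Let $d\in\{2,3\}$, $c:=1+\frac32(1+\sqrt3)$, let $Z,Z_0\in W^{1,d}(\Omega;\mathbb{R}^d)$, let $q\in L^\infty(\Omega)$ with $q\ge0$ and $q\det(DZ_0)\in L^\infty(\Omega)$, and let $\sigma(DZ_0)>0$ be a lower bound, valid a.e. in $\Omega$, for the smallest singular value of $DZ_0$. Then the Bregman divergence $$\mathcal{B}(Z,Z_0,q):=\int_\Omega q\,\Big(|\det(DZ)|-|\det(DZ_0)|-\mathrm{sgn}(\det(DZ_0))\,\mathrm{cof}(DZ_0):(DZ-DZ_0)\Big)\,dx$$ satisfies $$-\mathcal{B}(Z,Z_0,q)\le\frac{c}{2\,\sigma(DZ_0)^2}\,\|q\det(DZ_0)\|_{L^\infty(\Omega)}\,\|DZ-DZ_0\|_{L^2(\Omega)}^2 .$$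
   Context: $\Omega\subset\mathbb{R}^d$ is a bounded open set with smooth boundary. $\mathrm{cof}(M)$ is the cofactor matrix, $M^T\mathrm{cof}(M)=\det(M)I$; $A:B=\mathrm{tr}(A^TB)$; the $L^2$ norm of matrix fields uses the Frobenius norm. *)

(* Defs.v *)
From HB Require Import structures.
From mathcomp Require Import all_boot all_order all_algebra.
From mathcomp Require Import all_classical all_reals all_analysis.
From mathcomp Require Import measurable_realfun ess_sup_inf.

Set Implicit Arguments.
Unset Strict Implicit.
Unset Printing Implicit Defensive.

Import Order.TTheory GRing.Theory Num.Theory.
Import numFieldNormedType.Exports.

Local Open Scope classical_set_scope.
Local Open Scope ring_scope.

Section borel_matrix.
Variables (R : realType) (m n : nat).

HB.instance Definition _ :=
  @isMeasurable.Build (sigma_display (@open 'M[R]_(m, n))) 'M[R]_(m, n)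
    <<s @open 'M[R]_(m, n) >>
    (@sigma_algebra0 _ setT _) (@sigma_algebraC _ _)
    (@sigma_algebra_bigcup _ setT _).

Lemma open_measurable_mx (U : set 'M[R]_(m, n)) : open U -> measurable U.
Proof. exact: sub_sigma_algebra. Qed.

Let ratbox (ck : 'M[rat]_(m, n) * nat) : set 'M[R]_(m, n) :=
  [set x | forall i j, ball (ratr (ck.1 i j) : R) (ck.2.+1%:R^-1) (x i j)].

Let open_ratbox (U : set 'M[R]_(m, n)) : open U ->
  U = \bigcup_(ck in [set ck | ratbox ck `<=` U]) ratbox ck.
Proof.
move=> oU; apply/seteqP; split=> [x Ux|x [ck /= ckU]]; last exact: ckU.
have /nbhs_ballP[e /= e0 xeU] : nbhs x U by exact: open_nbhs_nbhs.
have [k _ kP] := @near_infty_natSinv_lt R (PosNum (divr_gt0 e0 (ltr0Sn R 1))).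
have {}kP : k.+1%:R^-1 < e / 2 :> R by exact: (kP k (leqnn k)).
have k0 : 0 < k.+1%:R^-1 :> R by [].
have rP i j : exists q : rat, ratr q \in `]x i j - k.+1%:R^-1, x i j + k.+1%:R^-1[.
  by apply: rat_in_itvoo; rewrite ltrD2l gtrN.
pose c : 'M[rat]_(m, n) := \matrix_(i, j) projT1 (cid (rP i j)).
have xc i j : ball (ratr (c i j) : R) k.+1%:R^-1 (x i j).
  rewrite mxE; case: cid => q /=; rewrite in_itv/= => /andP[q1 q2].
  by rewrite /ball/= ltr_distl; apply/andP; split.
exists (c, k); last exact: xc.
move=> y /= yc; apply: xeU; split => // i j.
apply: (@le_ball _ _ _ (k.+1%:R^-1 + k.+1%:R^-1)).
  by rewrite (le_trans (lerD (ltW kP) (ltW kP)))// -splitr.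
exact: ball_triangle (ball_sym (xc i j)) (yc i j).
Qed.

Lemma measurable_fun_mx d (T : measurableType d) (f : T -> 'M[R]_(m, n)) :
  (forall i j, measurable_fun setT (fun t => f t i j)) -> measurable_fun setT f.
Proof.
move=> mf; apply: (measurability (@open 'M[R]_(m, n))) => //.
move=> _ [U oU <-]; rewrite setTI (open_ratbox oU) preimage_bigcup.
rewrite bigcup_mkcond; apply: countable_bigcupT_measurable.
  exact: countableP.
move=> ck; case: ifPn => // _.
rewrite [X in measurable X](_ : _ = \bigcap_(i in [set: 'I_m])
    \bigcap_(j in [set: 'I_n])
      ((fun t => f t i j) @^-1` ball (ratr (ck.1 i j) : R) ck.2.+1%:R^-1)).
  apply: fin_bigcap_measurable => // i _.
  apply: fin_bigcap_measurable => // j _.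
  by rewrite -[X in measurable X]setTI; apply: mf => //; exact: open_measurable (ball_open _ _).
by apply/seteqP; split=> [t tc i _ j _|t tc i j]; exact: tc.
Qed.

End borel_matrix.

Section lebesgue_rV.
Variable R : realType.

Definition cons_rV n (x : R * 'rV[R]_n) : 'rV[R]_n.+1 :=
  row_mx (x.1%:M : 'rV_1) x.2.

Definition uncons_rV n (v : 'rV[R]_n.+1) : R * 'rV[R]_n :=
  (v 0 0, \row_j v 0 (lift ord0 j)).

Lemma measurable_coord m n (i : 'I_m) (j : 'I_n) :
  measurable_fun [set: 'M[R]_(m, n)] (fun A => A i j).
Proof.
apply: (measurability _ (RGenOpens.measurableE R)).
move=> _ [_ [a [b ->]] <-]; rewrite setTI; apply: open_measurable_mx.
apply: (@open_comp _ _ (fun A : 'M[R]_(m, n) => A i j)) => //.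
by move=> A _; exact: coord_continuous.
Qed.

Lemma measurable_cons_rV n : measurable_fun setT (@cons_rV n).
Proof.
apply: measurable_fun_mx => i j; rewrite /cons_rV.
case: (splitP (j : 'I_(1 + n))) => k jk.
  rewrite (_ : (fun t => _) = fst); first exact: measurable_fst.
  apply/funext => t; rewrite (_ : j = @lshift 1 n k); last exact/val_inj.
  by rewrite (@row_mxEl _ _ 1) mxE [i]ord1 [k]ord1 mulr1n.
rewrite (_ : (fun t => _) = (fun v : 'rV[R]_n => v i k) \o snd).
  by apply: measurableT_comp; [exact: measurable_coord|exact: measurable_snd].
apply/funext => t; rewrite (_ : j = @rshift 1 n k); last exact/val_inj.
by rewrite (@row_mxEr _ _ 1).
Qed.

Lemma measurable_uncons_rV n : measurable_fun setT (@uncons_rV n).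
Proof.
apply/measurable_fun_pairP; split; first exact: measurable_coord.
apply: measurable_fun_mx => i j.
rewrite (_ : (fun t => _) = (fun v : 'rV[R]_n.+1 => v 0 (lift ord0 j))).
  exact: measurable_coord.
by apply/funext => t; rewrite mxE.
Qed.

Lemma cons_rVK n : cancel (@cons_rV n) (@uncons_rV n).
Proof.
move=> [x v]; rewrite /uncons_rV /cons_rV; congr pair.
  rewrite (_ : 0 = @lshift 1 n 0); last exact/val_inj.
  by rewrite (@row_mxEl _ _ 1) mxE mulr1n.
apply/rowP => j; rewrite mxE (_ : lift _ _ = @rshift 1 n j); last exact/val_inj.
by rewrite (@row_mxEr _ _ 1).
Qed.

Section cons_measure.
Variables (n : nat) (mu : {sigma_finite_measure set 'rV[R]_n -> \bar R}).

Definition cons_measure : set 'rV[R]_n.+1 -> \bar R :=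
  pushforward (@lebesgue_measure R \x mu)%E (@cons_rV n).

Let cons_measure0 : cons_measure set0 = 0%E.
Proof. by rewrite /cons_measure /pushforward preimage_set0 measure0. Qed.

Let cons_measure_ge0 A : (0 <= cons_measure A)%E.
Proof. exact: (measure_ge0 (@lebesgue_measure R \x mu)%E). Qed.

Let cons_measure_sigma_additive : semi_sigma_additive cons_measure.
Proof.
exact: (@measure_semi_sigma_additive _ _ _
  (measure_function_pushforward__canonical__measure_function_Measure
    (@lebesgue_measure R \x mu)%E (@measurable_cons_rV n))).
Qed.

HB.instance Definition _ := isMeasure.Build _ _ _ cons_measure
  cons_measure0 cons_measure_ge0 cons_measure_sigma_additive.

Let cons_measure_sigma_finite : sigma_finite setT cons_measure.
Proof.
have /sigma_finiteP[F [TF ndF Foo]] := sigma_finiteT (@lebesgue_measure R).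
have /sigma_finiteP[G [TG ndG Goo]] := sigma_finiteT mu.
exists (fun k => @uncons_rV n @^-1` (F k `*` G k)).
  rewrite -preimage_bigcup (_ : \bigcup_k _ = setT) ?preimage_setT//.
  apply/seteqP; split=> // -[x y] _.
  have [[k _ Fkx] [l _ Gly]] : (\bigcup_k F k) x /\ (\bigcup_k G k) y.
    by rewrite -TF -TG.
  exists (maxn k l) => //; split.
  - by move: (x) Fkx; exact/subsetPset/ndF/leq_maxl.
  - by move: (y) Gly; exact/subsetPset/ndG/leq_maxr.
move=> k; have [mFk Fkoo] := Foo k; have [mGk Gkoo] := Goo k.
have mFG : measurable (F k `*` G k) by exact: measurableX.
split; first by rewrite -[X in measurable X]setTI; exact: measurable_uncons_rV.
rewrite /cons_measure /pushforward -comp_preimage.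
rewrite (_ : _ \o _ = id) ?preimage_id; last by apply/funext; exact: cons_rVK.
by rewrite product_measure1E// lte_mul_pinfty// ge0_fin_numE.
Qed.

HB.instance Definition _ := Measure_isSigmaFinite.Build _ _ _ cons_measure
  cons_measure_sigma_finite.

End cons_measure.

(* The n-fold product of one-dimensional Lebesgue measures, transported to
   'rV[R]_n; lebesgue_rV_box below computes it on boxes. *)
Fixpoint lebesgue_rV n : {sigma_finite_measure set 'rV[R]_n -> \bar R} :=
  if n is n'.+1 then cons_measure (lebesgue_rV n') else \d_(0 : 'rV[R]_0).

Lemma lebesgue_rV_box n (a b : 'I_n -> R) : (forall i, a i <= b i) ->
  lebesgue_rV n [set x | forall i, a i < x 0 i <= b i] =
  (\prod_(i < n) (b i - a i))%:E.
Proof.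
elim: n a b => [|n IH] a b ab /=.
  by rewrite big_ord0 diracE mem_set// => -[].
rewrite /cons_measure /pushforward big_ord_recl EFinM.
rewrite -(IH (fun i => a (lift ord0 i)) (fun i => b (lift ord0 i)))//.
rewrite (_ : @cons_rV n @^-1` _ = `]a ord0, b ord0]%classic `*`
    [set x : 'rV_n | forall i, a (lift ord0 i) < x 0 i <= b (lift ord0 i)]).
  rewrite product_measure1E//=; last first.
    rewrite (_ : [set _ | _] = \bigcap_(i in [set: 'I_n])
        ((fun x : 'rV[R]_n => x 0 i) @^-1`
          `]a (lift ord0 i), b (lift ord0 i)]%classic)).
      apply: fin_bigcap_measurable => // i _.
      by rewrite -[X in measurable X]setTI; apply: measurable_coord.
    by apply/seteqP; split=> [x xab i _|x xab i]; have := xab i;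
      rewrite /= in_itv//=; apply.
  by rewrite lebesgue_measure_itv/= lte_fin lt_neqAle ab andbT; case: eqVneq =>
    [->|//]; rewrite subrr.
apply/seteqP; split=> [[x v] /= xv|[x v] /= [xab vab] i].
  have xE := cons_rVK (x, v); rewrite /uncons_rV in xE; case: xE => x0 vE.
  split; first by have := xv ord0; rewrite in_itv/= x0.
  by move=> i; have := xv (lift ord0 i); rewrite -vE mxE.
have xE := cons_rVK (x, v); rewrite /uncons_rV in xE; case: xE => x0 vE.
have [->|[j ->]] : i = ord0 \/ exists j, i = lift ord0 j.
  by case: (unliftP ord0 i) => [j ->|->]; [right; exists j|left].
  by rewrite in_itv/= in xab; rewrite x0.
by have := vab j; rewrite -[in X in X -> _]vE mxE.
Qed.

End lebesgue_rV.

Section function_spaces.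
Variables (R : realType) (n : nat).
Implicit Types (Om : set 'rV[R]_n) (f u v phi : 'rV[R]_n -> R).

(* Functions on Om are total functions, restricted to Om and extended by 0:
   f \_ Om is measurable and has finite p-norm on the whole space iff f is so
   on Om. *)
Definition in_Lp Om (p : \bar R) f : Prop :=
  (f \_ Om) \in Lfun (lebesgue_rV R n) p.

Definition Lp_norm Om (p : \bar R) f : \bar R :=
  Lnorm (lebesgue_rV R n) p (EFin \o (f \_ Om)).

Definition partial (j : 'I_n) f : 'rV[R]_n -> R :=
  fun x => 'D_(delta_mx 0 j) f x.

(* f is C^oo iff all its iterated partial derivatives, including f itself, are
   everywhere (Frechet) differentiable. *)
Definition smooth f : Prop :=
  forall (s : seq 'I_n) (x : 'rV[R]_n), differentiable (foldr partial f s) x.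

Definition test_function Om phi : Prop :=
  let K := closure [set x | phi x != 0] in
  [/\ smooth phi, compact K & K `<=` Om].

(* v is the weak j-th partial derivative of u on Om (for u and v locally
   integrable on Om). *)
Definition weak_partial Om (j : 'I_n) u v : Prop :=
  forall phi, test_function Om phi ->
    (\int[lebesgue_rV R n]_(x in Om) (u x * partial j phi x)%:E =
     - \int[lebesgue_rV R n]_(x in Om) (v x * phi x)%:E)%E.

(* Z belongs to W^{1,p}(Om; R^m) and DZ is a version of its weak Jacobian
   matrix, (DZ)_ij = d_j Z_i. *)
Definition in_W1p m Om (p : \bar R) (Z : 'rV[R]_n -> 'rV[R]_m)
    (DZ : 'rV[R]_n -> 'M[R]_(m, n)) : Prop :=
  [/\ forall i, in_Lp Om p (fun x => Z x 0 i),
      forall i j, in_Lp Om p (fun x => DZ x i j) &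
      forall i j, weak_partial Om j (fun x => Z x 0 i) (fun x => DZ x i j)].

End function_spaces.

(* Near each of its boundary points, and after relabelling and reorienting the
   coordinate axes, Om is the region above the graph of a C^oo function of the
   other n - 1 coordinates. *)
Definition smooth_boundary (R : realType) n (Om : set 'rV[R]_n) : Prop :=
  forall x0, (closure Om `\` interior Om) x0 ->
    exists (i : 'I_n) (b : bool) (g : 'rV[R]_n.-1 -> R),
      smooth g /\
      \forall x \near x0, Om x <-> g (col' i x) < (-1) ^+ b * x 0 i.

Section matrices.
Variables (R : realType) (n : nat).
Implicit Types A B : 'M[R]_n.

Definition cof A : 'M[R]_n := \matrix_(i, j) cofactor A i j.

Lemma cofE A : A^T *m cof A = (\det A)%:M.
Proof.
rewrite (_ : cof A = (\adj A)^T); last by apply/matrixP => i j; rewrite !mxE.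
by rewrite -trmx_mul mul_adj_mx tr_scalar_mx.
Qed.

Definition frob_dot A B : R := \tr (A^T *m B).

Definition frob_norm A : R := Num.sqrt (frob_dot A A).

Definition singular_value A (s : R) : Prop :=
  0 <= s /\ eigenvalue (A^T *m A) (s ^+ 2).

(* The set of singular values is finite, and nonempty for n > 0, so this
   infimum is a minimum. *)
Definition smallest_singular_value A : R := inf [set s | singular_value A s].

End matrices.

(* The divergence depends on Z and Z0 through their weak Jacobians only. *)
Definition bregman (R : realType) n (Om : set 'rV[R]_n)
    (DZ DZ0 : 'rV[R]_n -> 'M[R]_n) (q : 'rV[R]_n -> R) : \bar R :=
  (\int[lebesgue_rV R n]_(x in Om)
    (q x * (`|\det (DZ x)| - `|\det (DZ0 x)|
            - Num.sg (\det (DZ0 x)) *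
              frob_dot (cof (DZ0 x)) (DZ x - DZ0 x)))%:E)%E.

(* Main.v *)
Require Import Defs.
From HB Require Import structures.
From mathcomp Require Import all_boot all_order all_algebra.
From mathcomp Require Import all_classical all_reals all_analysis.
From mathcomp Require Import ring lra.
From mathcomp Require Import measurable_realfun ess_sup_inf.

(** Write [DZ - DZ0 = DZ0 *m M].  Since [(cof A)^T *m A] is the scalar matrix
    [\det A], the integrand is
    [q * |\det DZ0| * (|\det (1 + M)| - 1 - \tr M)], and in dimensions 2 and 3
    [1 + \tr M - |\det (1 + M)| <= 5 / 2 * |M|^2 <= c / 2 * |M|^2].  The variational
    characterization of the smallest singular value gives
    [sigma * |M| <= |DZ - DZ0|], so the negative part of the integrand is bounded
    a.e. by [c / (2 sigma^2) * |q \det DZ0| * |DZ - DZ0|^2]; integrate. *)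

Set Implicit Arguments.
Unset Strict Implicit.
Unset Printing Implicit Defensive.

Import Order.TTheory GRing.Theory Num.Theory.
Import numFieldNormedType.Exports.

Local Open Scope classical_set_scope.
Local Open Scope ring_scope.

(** * Quadratic forms and the Rayleigh quotient of a symmetric matrix *)

Section rayleigh.
Variables (R : realType) (n : nat).
Implicit Types (B C : 'M[R]_n) (x y : 'rV[R]_n).

Definition bilin B x y : R := (x *m B *m y^T) 0 0.

Definition sqnorm x : R := (x *m x^T) 0 0.

Lemma bilinE B x y : bilin B x y = \sum_j \sum_i x 0 i * B i j * y 0 j.
Proof.
rewrite /bilin mxE; apply: eq_bigr => j _.
by rewrite !mxE mulr_suml.
Qed.

Lemma sqnormE x : sqnorm x = \sum_i x 0 i ^+ 2.
Proof. by rewrite /sqnorm mxE; apply: eq_bigr => i _; rewrite mxE. Qed.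

Lemma sqnorm_ge0 x : 0 <= sqnorm x.
Proof. by rewrite sqnormE sumr_ge0// => i _; rewrite sqr_ge0. Qed.

Lemma sqr_coord_le_sqnorm x i : x 0 i ^+ 2 <= sqnorm x.
Proof.
by rewrite sqnormE (bigD1 i)//= lerDl sumr_ge0// => j _; rewrite sqr_ge0.
Qed.

Lemma bilin_bounded B :
  exists2 K, 0 < K & forall x, `|bilin B x x| <= K * sqnorm x.
Proof.
(* The summand 1 keeps the constant positive when [B] is zero. *)
exists (1 + \sum_j \sum_i `|B i j|).
  by rewrite ltr_wpDr// sumr_ge0// => j _; rewrite sumr_ge0.
move=> x; rewrite bilinE mulrDl mul1r ler_wpDl ?sqnorm_ge0//.
rewrite mulr_suml (le_trans (ler_norm_sum _ _ _))// ler_sum// => j _.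
rewrite mulr_suml (le_trans (ler_norm_sum _ _ _))// ler_sum// => i _.
rewrite mulrAC normrM mulrC ler_wpM2l//.
have := sqr_coord_le_sqnorm x i; have := sqr_coord_le_sqnorm x j.
have := sqr_ge0 (x 0 i - x 0 j); have := sqr_ge0 (x 0 i + x 0 j).
by rewrite ler_norml => *; apply/andP; split; nra.
Qed.

Lemma bilin_scalar a x : bilin a%:M x x = a * sqnorm x.
Proof. by rewrite /bilin mul_mx_scalar -scalemxAl mxE. Qed.

Lemma bilinB B C x : bilin (B - C) x x = bilin B x x - bilin C x x.
Proof. by rewrite /bilin mulmxBr mulmxBl !mxE. Qed.

(* Expanding the form at [x - t xC], with [t] the inverse of a bound for it. *)
Lemma sqnorm_mulmx_le_bilin C : C^T = C -> (forall x, 0 <= bilin C x x) ->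
  exists2 L, 0 < L & forall x, sqnorm (x *m C) <= L * bilin C x x.
Proof.
move=> Csym Cge0; have [L L0 LP] := bilin_bounded C.
exists L => // x; set y := x *m C.
have Ny : bilin C y y <= L * sqnorm y by rewrite (le_trans (ler_norm _)).
(* The factor [L ^+ 2] clears the denominators of the expansion. *)
have /(mulr_ge0 (sqr_ge0 L)) := Cge0 (x - L^-1 *: y).
have yx : bilin C y x = sqnorm y.
  by rewrite /bilin /sqnorm /y -mulmxA -{2}Csym -trmx_mul.
have xy : bilin C x y = sqnorm y by [].
have -> : bilin C (x - L^-1 *: y) (x - L^-1 *: y) =
    bilin C x x - L^-1 * bilin C x y - L^-1 * bilin C y x
      + L^-1 ^+ 2 * bilin C y y.
  have xyT : (x - L^-1 *: y)^T = x^T - L^-1 *: y^T.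
    by apply/matrixP => i j; rewrite !mxE.
  rewrite /bilin xyT !mulmxBl !mulmxBr -!scalemxAl -!scalemxAr.
  by rewrite !mxE; ring.
rewrite xy yx.
have -> : L ^+ 2 * (bilin C x x - L^-1 * sqnorm y - L^-1 * sqnorm y +
    L^-1 ^+ 2 * bilin C y y) =
  L * (L * bilin C x x - sqnorm y) - L * sqnorm y + bilin C y y.
  by field; rewrite gt_eqF.
move=> H; rewrite -subr_ge0 -(pmulr_rge0 _ L0); lra.
Qed.

Lemma eigenvalue_nonunit B a : ~~ (B - a%:M \in unitmx) -> eigenvalue B a.
Proof. by rewrite -row_free_unit -kermx_eq0. Qed.

(* The infimum [a] of the Rayleigh quotient is an eigenvalue: otherwise
   [B - a%:M] is invertible and nonnegative, hence bounded below by a positive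
   multiple of the identity. *)
Lemma symmetric_eigenvalue_le_bilin B : (0 < n)%N -> B^T = B ->
  exists2 a, eigenvalue B a & forall x, a * sqnorm x <= bilin B x x.
Proof.
move=> n0 Bsym; pose S := [set a | forall x, a * sqnorm x <= bilin B x x].
have [K K0 KP] := bilin_bounded B.
have SK : S (- K).
  by move=> x; rewrite mulNr; have := KP x; rewrite ler_norml => /andP[].
have Sub : ubound S K.
  (* A unit basis vector, available as [n] is positive, bounds every member of [S] by [K]. *)
  move=> a aS; pose x : 'rV[R]_n := delta_mx 0 (Ordinal n0).
  have x1 : sqnorm x = 1.
    rewrite sqnormE (bigD1 (Ordinal n0))//= big1.
      by rewrite mxE !eqxx expr1n addr0.
    by move=> i /negbTE i0; rewrite mxE i0 andbF expr0n.
  have := aS x; have := KP x; rewrite ler_norml x1 !mulr1 => /andP[_].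
  by move=> xK ax; exact: le_trans ax xK.
have supS : has_sup S by split; [exists (- K)|exists K].
have S_sup : S (sup S).
  move=> x; have := sqnorm_ge0 x; rewrite le_eqVlt => /predU1P[x0|x0].
    by have := SK x; rewrite -x0 !mulr0.
  rewrite -ler_pdivlMr//; apply: ge_sup; first by exists (- K).
  by move=> a aS; rewrite ler_pdivlMr.
exists (sup S) => //; apply: eigenvalue_nonunit; apply/negP.
set C := B - _ => Cu.
have Cge0 x : 0 <= bilin C x x by rewrite bilinB bilin_scalar subr_ge0.
have Csym : C^T = C by rewrite linearB/= Bsym tr_scalar_mx.
have [L L0 LP] := sqnorm_mulmx_le_bilin Csym Cge0.
(* Since [x] is [x *m C] times [invmx C], one gets [sqnorm x <= M * sqnorm (x *m C) <= M * L * bilin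
   C x x]. Hence [sup S] can be raised by [(M * L)^-1], a contradiction. *)
have [M M0 MP] := bilin_bounded (invmx C *m (invmx C)^T).
have ML : 0 < M * L by rewrite mulr_gt0.
have : S (sup S + (M * L)^-1).
  move=> x; rewrite mulrDl -lerBrDl -(bilin_scalar (sup S)) -bilinB -/C ler_pdivrMl//.
  rewrite -mulrA (le_trans _ (ler_wpM2l (ltW M0) (LP x)))//.
  rewrite (le_trans _ (MP (x *m C)))// (le_trans _ (ler_norm _))//.
  by rewrite /bilin /sqnorm mulmxA mulmxK// -mulmxA -trmx_mul mulmxK.
move/(sup_upper_bound supS); rewrite gerDl leNgt invr_gt0 ML//.
Qed.

End rayleigh.

(** * Frobenius product and the smallest singular value *)

Section frobenius.
Variables (R : realType) (n : nat).
Implicit Types A M : 'M[R]_n.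

Lemma frob_dotE A M : frob_dot A M = \sum_i \sum_j A i j * M i j.
Proof.
rewrite /frob_dot /mxtrace exchange_big; apply: eq_bigr => j _.
by rewrite mxE; apply: eq_bigr => i _; rewrite mxE.
Qed.

Lemma frob_dot_ge0 M : 0 <= frob_dot M M.
Proof.
by rewrite frob_dotE; do 2!apply: sumr_ge0 => ? _; rewrite -expr2 sqr_ge0.
Qed.

Lemma frob_norm_sqr M : frob_norm M ^+ 2 = frob_dot M M.
Proof. by rewrite sqr_sqrtr ?frob_dot_ge0. Qed.

Lemma smallest_singular_value_le A s :
  singular_value A s -> smallest_singular_value A <= s.
Proof. by apply: ge_inf; exists 0 => t []. Qed.

(** The least eigenvalue [a] of [A^T *m A] bounds the form from below, and its square root is a
    singular value, so [s ^+ 2 <= a]. *)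
Lemma smallest_singular_value_bilin (s : R) A (n0 : (0 < n)%N) : 0 <= s ->
  s <= smallest_singular_value A ->
  forall x, s ^+ 2 * sqnorm x <= bilin (A^T *m A) x x.
Proof.
move=> s0 sA x.
have [|a Ba aP] := symmetric_eigenvalue_le_bilin n0 (_ : (A^T *m A)^T = _).
  by rewrite trmx_mul trmxK.
(* For an eigenvector [v], [a * sqnorm v] is the square norm of [v *m A^T]. *)
have a0 : 0 <= a.
  have /eigenvalueP[v vP v0] := Ba.
  have vN : 0 < sqnorm v.
    rewrite lt_neqAle sqnorm_ge0 andbT eq_sym; apply: contra v0 => /eqP vN.
    apply/eqP/rowP => i; rewrite mxE; apply/eqP.
    by rewrite -sqrf_eq0 eq_le sqr_ge0 -{1}vN sqr_coord_le_sqnorm.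
  have : bilin (A^T *m A) v v = a * sqnorm v.
    by rewrite /bilin vP -scalemxAl mxE.
  have -> : bilin (A^T *m A) v v = sqnorm (v *m A^T).
    by rewrite /bilin /sqnorm trmx_mul trmxK !mulmxA.
  by move=> E; rewrite -(pmulr_lge0 _ vN) -E sqnorm_ge0.
rewrite (le_trans _ (aP x))// ler_wpM2r ?sqnorm_ge0//.
rewrite -[leRHS](sqr_sqrtr a0) lerXn2r ?nnegrE ?sqrtr_ge0//.
apply: (le_trans sA); apply: smallest_singular_value_le.
by split; rewrite ?sqrtr_ge0 ?sqr_sqrtr.
Qed.

(** The squared Frobenius norm is the sum of the squared norms of the columns, and [A] acts on each
    column of [M] separately. *)
Lemma frob_dot_mulmx_ge (s : R) A M : (0 < n)%N -> 0 <= s ->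
  s <= smallest_singular_value A ->
  s ^+ 2 * frob_dot M M <= frob_dot (A *m M) (A *m M).
Proof.
move=> n0 s0 sA; rewrite /frob_dot /mxtrace mulr_sumr ler_sum// => j _.
have := smallest_singular_value_bilin n0 s0 sA (row j M^T).
rewrite /bilin /sqnorm tr_row trmxK trmx_mul.
rewrite -!row_mul -[(M^T *m A^T) *m _]mulmxA.
have rc (P : 'M[R]_n) : row j (P *m col j M) 0 0 = (P *m M) j j.
  by rewrite !mxE; apply: eq_bigr => k _; rewrite !mxE.
by rewrite !rc !mulmxA.
Qed.

End frobenius.

(** * Second-order lower bounds for the determinant near the identity *)

Section determinant_bound.
Variable R : realType.

(** Indices 1 and 2, in the form that [big_ord_recl] produces. *)
Let o1 {n} : 'I_n.+2 := lift ord0 ord0.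
Let o2 : 'I_3 := lift ord0 (lift ord0 ord0).

Lemma det_mx22 (A : 'M[R]_2) :
  \det A = A ord0 ord0 * A o1 o1 - A ord0 o1 * A o1 ord0.
Proof.
rewrite (expand_det_row _ ord0) /cofactor !(big_ord_recl, big_ord0)/=.
rewrite !det_mx11 !mxE /bump/= addr0.
have -> : lift o1 0 = ord0 :> 'I_2 by exact/val_inj.
by rewrite -/o1 !expr0 !expr1 mulN1r mulrN mul1r.
Qed.

Lemma det_mx33 (A : 'M[R]_3) :
  \det A = A ord0 ord0 * (A o1 o1 * A o2 o2 - A o1 o2 * A o2 o1)
         - A ord0 o1 * (A o1 ord0 * A o2 o2 - A o1 o2 * A o2 ord0)
         + A ord0 o2 * (A o1 ord0 * A o2 o1 - A o1 o1 * A o2 ord0).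
Proof.
rewrite (expand_det_row _ ord0) /cofactor !(big_ord_recl, big_ord0)/=.
rewrite !det_mx22 !mxE /bump/= addr0.
have e10 : lift o1 ord0 = ord0 :> 'I_3 by exact/val_inj.
have e11 : lift o1 o1 = o2 :> 'I_3 by exact/val_inj.
have e20 : lift o2 ord0 = ord0 :> 'I_3 by exact/val_inj.
have e21 : lift o2 o1 = o1 :> 'I_3 by exact/val_inj.
rewrite -/o1 -/o2 !(e10, e11, e20, e21) /o2 -/o1.
by rewrite !exprS !expr0; ring.
Qed.

(** Dropping the absolute value leaves [b * c - a * d], which is at most half the squared norm; the
    constant [5 / 2] is the one dimension 3 asks for. *)
Lemma det_add1_bound2 (M : 'M[R]_2) :
  1 + \tr M - `|\det (1%:M + M)| <= 5 / 2 * frob_dot M M.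
Proof.
rewrite frob_dotE det_mx22 /mxtrace !(big_ord_recl, big_ord0) -/o1 !mxE/=.
rewrite !addr0 mulr1n mulr0n !add0r.
set a := M ord0 ord0; set b := M ord0 o1; set c := M o1 ord0; set d := M o1 o1.
have := ler_norm ((1 + a) * (1 + d) - b * c).
have := sqr_ge0 (a + d); have := sqr_ge0 (b - c).
have := sqr_ge0 a; have := sqr_ge0 b; have := sqr_ge0 c; have := sqr_ge0 d.
nra.
Qed.

(** Hadamard's inequality: Cauchy-Schwarz for the first row against the cross product of the other
    two, whose norm is bounded by Lagrange's identity. The middle component [y] has its sign
    flipped. *)
Lemma sqr_det3_le (a b c d e f g h i : R) :
  (a * (e * i - f * h) - b * (d * i - f * g) + c * (d * h - e * g)) ^+ 2 <=
  (a ^+ 2 + b ^+ 2 + c ^+ 2) * (d ^+ 2 + e ^+ 2 + f ^+ 2) *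
  (g ^+ 2 + h ^+ 2 + i ^+ 2).
Proof.
set x := e * i - f * h; set y := d * i - f * g; set z := d * h - e * g.
have cross : x ^+ 2 + y ^+ 2 + z ^+ 2 <=
    (d ^+ 2 + e ^+ 2 + f ^+ 2) * (g ^+ 2 + h ^+ 2 + i ^+ 2).
  have := sqr_ge0 (d * g + e * h + f * i).
  by rewrite /x /y /z; lra.
rewrite -mulrA (le_trans _ (ler_wpM2l _ cross)) ?addr_ge0 ?sqr_ge0//.
have := sqr_ge0 (a * y + b * x); have := sqr_ge0 (a * z - c * x).
by have := sqr_ge0 (b * z + c * y); lra.
Qed.

(** Beyond [1 + \tr M], the determinant consists of the principal 2 by 2 minors, whose sum is at
    least [- S / 2], and of [D], which is at least [- 2 * S] when [S <= 4]. Together they give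
    [5 / 2]. *)
Lemma det_add1_bound3 (M : 'M[R]_3) :
  1 + \tr M - `|\det (1%:M + M)| <= 5 / 2 * frob_dot M M.
Proof.
rewrite frob_dotE det_mx33 /mxtrace !(big_ord_recl, big_ord0) -/o1 -/o2 !mxE/=.
rewrite !addr0 mulr1n mulr0n !add0r -!expr2.
set a := M ord0 ord0; set b := M ord0 o1; set c := M ord0 o2.
set d := M o1 ord0; set e := M o1 o1; set f := M o1 o2.
set g := M o2 ord0; set h := M o2 o1; set i := M o2 o2.
set S := (X in _ <= _ * X); set N := `|_|.
have D2 := sqr_det3_le a b c d e f g h i; set D := (X in X ^+ 2 <= _) in D2.
have [r1 r2 r3] : [/\ 0 <= a ^+ 2 + b ^+ 2 + c ^+ 2,
    0 <= d ^+ 2 + e ^+ 2 + f ^+ 2 & 0 <= g ^+ 2 + h ^+ 2 + i ^+ 2].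
  by split; rewrite !addr_ge0 ?sqr_ge0.
(* Each diagonal entry [t] satisfies [t <= (t ^+ 2 + 1) / 2]. *)
have tr2 : 1 + (a + (e + i)) <= 5 / 2 + S / 2.
  rewrite /S; have := sqr_ge0 (a - 1); have := sqr_ge0 (e - 1).
  have := sqr_ge0 (i - 1).
  have := sqr_ge0 b; have := sqr_ge0 c; have := sqr_ge0 d.
  have := sqr_ge0 f; have := sqr_ge0 g; have := sqr_ge0 h; lra.
(* If [4 < S], the trace is dominated by [S] alone; otherwise the cubic term of
   the expansion satisfies [D ^+ 2 <= S ^+ 3 <= 4 * S ^+ 2]. *)
have [S4|S4] := lerP S 4; last first.
  have : 0 <= N by exact: normr_ge0.
  lra.
have DS : `|D| <= 2 * S.
  rewrite -(@ler_pXn2r _ 2) ?nnegrE//; last by rewrite /S; lra.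
  rewrite real_normK ?num_real// (le_trans D2)//.
  have SE : S = (a ^+ 2 + b ^+ 2 + c ^+ 2) + (d ^+ 2 + e ^+ 2 + f ^+ 2) +
     (g ^+ 2 + h ^+ 2 + i ^+ 2) by rewrite /S; ring.
  rewrite SE in S4 *; move: r1 r2 r3 S4.
  set x := _ + c ^+ 2; set y := _ + f ^+ 2; set z := _ + i ^+ 2.
  clear; move=> x0 y0 z0 S4.
  have : x * y <= (x + y + z) ^+ 2 by nra.
  have : z * (x * y) <= 4 * (x * y).
    by rewrite ler_wpM2r ?mulr_ge0//; lra.
  lra.
have : 1 + (a + (e + i)) + (a * e + a * i + e * i - b * d - c * g - f * h) + D <= N.
  rewrite (le_trans _ (ler_norm _))// /D; lra.
have := sqr_ge0 (a + e + i); have := sqr_ge0 (b - d); have := sqr_ge0 (c - g).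
have := sqr_ge0 (f - h).
move: DS; rewrite ler_norml => /andP[DS _].
move: DS; rewrite /S; clearbody D N; clear; lra.
Qed.

End determinant_bound.

(** * The pointwise bound on the integrand *)

Section bregman_integrand.
Variables (R : realType) (n : nat).
Implicit Types A M : 'M[R]_n.

Lemma tr_cof A : (cof A)^T = \adj A.
Proof. by apply/matrixP => i j; rewrite !mxE. Qed.

Lemma det_linearization_mul A M :
  `|\det (A *m (1%:M + M))| - `|\det A|
    - Num.sg (\det A) * frob_dot (cof A) (A *m M) =
  - (`|\det A| * (1 + \tr M - `|\det (1%:M + M)|)).
Proof.
rewrite /frob_dot tr_cof mulmxA mul_adj_mx mul_scalar_mx mxtraceZ.
rewrite mulrA -normrEsg det_mulmx normrM; ring.
Qed.

Lemma det_linearization_bound (s : R) A A' : n = 2%N \/ n = 3%N -> 0 < s ->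
  s <= smallest_singular_value A ->
  - (`|\det A'| - `|\det A| - Num.sg (\det A) * frob_dot (cof A) (A' - A))
    <= 5 / 2 / s ^+ 2 * `|\det A| * frob_dot (A' - A) (A' - A).
Proof.
move=> n23 s0 sA; have n0 : (0 < n)%N by case: n23 => ->.
(* A singular [A] would have the singular value 0, below [s]. *)
have Au : A \in unitmx.
  apply/negPn/negP => kA; have : singular_value A 0.
    split; rewrite // expr0n; apply: eigenvalue_nonunit.
    by rewrite raddf0 subr0 unitmx_mul unitmx_tr (negbTE kA).
  by move/smallest_singular_value_le; rewrite leNgt (lt_le_trans s0).
pose M := invmx A *m (A' - A).
have AM : A' - A = A *m M by rewrite mulKVmx.
have -> : A' = A *m (1%:M + M) by rewrite mulmxDr mulmx1 -AM addrC subrK.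
have -> : A *m (1%:M + M) - A = A *m M by rewrite mulmxDr mulmx1 addrC addKr.
rewrite det_linearization_mul opprK mulrAC [leRHS]mulrC ler_wpM2l//.
apply: (@le_trans _ _ (5 / 2 * frob_dot M M)).
  case: n23 => n23; move: (M); rewrite n23 => M'.
    exact: det_add1_bound2.
  exact: det_add1_bound3.
rewrite -[leRHS]mulrA ler_wpM2l// ler_pdivlMl ?exprn_gt0//.
exact: frob_dot_mulmx_ge (ltW s0) _.
Qed.

End bregman_integrand.

(** * Integrals, norms and measurability *)

Section integral_bounds.
Context d (T : measurableType d) (R : realType).
Variable mu : {measure set T -> \bar R}.

(* The bound survives the junk value [+oo - +oo = -oo]: both sides are then
   [+oo]. *)
Lemma oppe_integral_le_funeneg (D : set T) (f : T -> \bar R) :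
  (- (\int[mu]_(x in D) f x) <= \int[mu]_(x in D) f^\- x)%E.
Proof.
rewrite integralE.
have : (0 <= \int[mu]_(x in D) f^\+ x)%E by apply: integral_ge0.
have : (0 <= \int[mu]_(x in D) f^\- x)%E by apply: integral_ge0.
case: (\int[mu]_(x in D) f^\- x)%E => [a| |]//; last by move=> _ _; rewrite leey.
case: (\int[mu]_(x in D) f^\+ x)%E => [b| |]//=; last by move=> _ _; rewrite leNye.
by rewrite !lee_fin => _ b0; rewrite opprB gerBl.
Qed.

Lemma ae_le_Lnormy (f : T -> \bar R) :
  \forall x \ae mu, (`|f x| <= 'N[mu]_+oo [f])%E.
Proof.
rewrite unlock; case: ifPn => [_|]; first exact: ess_sup_ge.
(* If the whole space is null, the sup norm is given by a separate default, and the exceptional set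
   can be everything. *)
rewrite -leNgt => mu0; exists setT; split => //.
by apply/eqP; rewrite eq_le mu0 measure_ge0.
Qed.

Lemma sqr_Lnorm2 (f : T -> R) :
  ('N[mu]_2%:E [EFin \o f] ^+ 2 = \int[mu]_x (f x ^+ 2)%:E)%E.
Proof.
have := @poweR_Lnorm _ _ _ mu (EFin \o f) 2 (lt0r_neq0 (ltr0Sn R 1)).
have := Lnorm_ge0 mu 2%:E (EFin \o f).
set N := Lnorm _ _ _ => N0.
rewrite [X in _ = X -> _](_ : _ = \int[mu]_x (f x ^+ 2)%:E)%E; last first.
  apply: eq_integral => x _ /=.
  by rewrite powR_mulrn// real_normK// num_real.
(* The real power 2 agrees with the square for a finite nonnegative norm, and both are infinite for
   an infinite one. *)
move=> <-; case: N N0 => [r| |]//=.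
  by rewrite lee_fin => r0; rewrite powR_mulrn.
by rewrite pnatr_eq0.
Qed.

Lemma measurable_fun_det n (D : set T) (f : T -> 'M[R]_n) :
  (forall i j, measurable_fun D (fun x => f x i j)) ->
  measurable_fun D (fun x => \det (f x)).
Proof.
move=> mf; apply: measurable_sum => s; apply: measurable_funM => //.
by apply: measurable_prod => i _; exact: mf.
Qed.

Lemma measurable_fun_frob_dot n (D : set T) (f g : T -> 'M[R]_n) :
  (forall i j, measurable_fun D (fun x => f x i j)) ->
  (forall i j, measurable_fun D (fun x => g x i j)) ->
  measurable_fun D (fun x => frob_dot (f x) (g x)).
Proof.
move=> mf mg; under eq_fun do rewrite frob_dotE.
by do 2!apply: measurable_sum => ?; exact: measurable_funM.
Qed.

Lemma measurable_fun_cof n (D : set T) (f : T -> 'M[R]_n) i j :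
  (forall i j, measurable_fun D (fun x => f x i j)) ->
  measurable_fun D (fun x => cof (f x) i j).
Proof.
move=> mf; under eq_fun do rewrite mxE.
apply: measurable_funM => //; apply: measurable_fun_det => k l.
by under eq_fun do rewrite !mxE; exact: mf.
Qed.

Lemma measurable_fun_sg (D : set T) (f : T -> R) :
  measurable_fun D f -> measurable_fun D (fun x => Num.sg (f x)).
Proof.
apply: (@measurableT_comp _ _ _ _ _ _ (@Num.sg R)).
apply: nondecreasing_measurable => // x y xy.
by case: (sgrP x) xy => [->|x0|x0]; case: (sgrP y) => // y0; lra.
Qed.

End integral_bounds.

Lemma in_Lp_measurable (R : realType) n (Om : set 'rV[R]_n) p f :
  measurable Om -> in_Lp Om p f -> measurable_fun Om f.
Proof.
by move=> mOm /sub_Lfun_mfun; rewrite inE => mf; apply/measurable_restrictT.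
Qed.

(** * The estimate for the Bregman divergence *)

Theorem mainTheorem5 (R : realType) (d : nat) (hd : d = 2%N \/ d = 3%N)
    (Om : set 'rV[R]_d) (Om_open : open Om) (Om_bounded : bounded_set Om)
    (Om_smooth : smooth_boundary Om)
    (Z Z0 : 'rV[R]_d -> 'rV[R]_d) (DZ DZ0 : 'rV[R]_d -> 'M[R]_d)
    (hZ : in_W1p Om d%:R%:E Z DZ) (hZ0 : in_W1p Om d%:R%:E Z0 DZ0)
    (q : 'rV[R]_d -> R) (q_Loo : in_Lp Om +oo%E q)
    (q_ge0 : {ae lebesgue_rV R d, forall x, Om x -> 0 <= q x})
    (qdet_Loo : in_Lp Om +oo%E (fun x => q x * \det (DZ0 x)))
    (sigma : R) (sigma_gt0 : 0 < sigma)
    (sigma_le : {ae lebesgue_rV R d, forall x, Om x ->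
       sigma <= smallest_singular_value (DZ0 x)}) :
  let c : R := 1 + 3 / 2 * (1 + Num.sqrt 3) in
  (- bregman Om DZ DZ0 q <=
   (c / (2 * sigma ^+ 2))%:E *
   Lp_norm Om +oo (fun x => q x * \det (DZ0 x))%R *
   Lp_norm Om 2%:E (fun x => frob_norm (DZ x - DZ0 x))%R ^+ 2)%E.
Proof.
cbv zeta; set c := 1 + 3 / 2 * _; have mOm : measurable Om by exact: open_measurable_mx.
have mD i j : measurable_fun Om (fun x => DZ x i j).
  by case: hZ => _ + _ => /(_ i j); exact: in_Lp_measurable.
have mD0 i j : measurable_fun Om (fun x => DZ0 x i j).
  by case: hZ0 => _ + _ => /(_ i j); exact: in_Lp_measurable.
have mq := in_Lp_measurable mOm q_Loo.
have mE i j : measurable_fun Om (fun x => (DZ x - DZ0 x) i j).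
  by under eq_fun do rewrite !mxE; exact: measurable_funB.
pose h x := frob_dot (DZ x - DZ0 x) (DZ x - DZ0 x).
have mh : measurable_fun Om (EFin \o h).
  by apply/measurable_EFinP; exact: measurable_fun_frob_dot.
(* This makes the determinant constant [5 / 2] at most [c / 2]; it follows from [25 / 9 <= 3]. *)
have c5 : 5 <= c.
  have : 5 / 3 <= Num.sqrt 3 :> R.
    by rewrite -(@ler_pXn2r _ 2) ?nnegrE ?sqrtr_ge0// sqr_sqrtr//; lra.
  by rewrite /c; lra.
have cs0 : 0 <= c / (2 * sigma ^+ 2).
  by rewrite divr_ge0 ?mulr_ge0 ?sqr_ge0//; lra.
have -> : (Lp_norm Om 2%:E (fun x => frob_norm (DZ x - DZ0 x)) ^+ 2 =
    \int[lebesgue_rV R d]_(x in Om) (h x)%:E)%E.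
  rewrite /Lp_norm sqr_Lnorm2 [RHS]integral_mkcond; apply: eq_integral => x _.
  by rewrite /patch; case: ifPn => _; rewrite ?frob_norm_sqr ?expr0n.
set N := Lp_norm _ _ _; have N0 : (0 <= N)%E by exact: Lnorm_ge0.
have NP := ae_le_Lnormy (lebesgue_rV R d)
  (EFin \o ((fun x => q x * \det (DZ0 x)) \_ Om)).
(* Both integrands are now nonnegative, so an a.e. pointwise comparison suffices. *)
apply: le_trans (oppe_integral_le_funeneg _ _ _) _.
rewrite -ge0_integralZl//; last 2 first.
- by move=> x _; rewrite lee_fin frob_dot_ge0.
- by rewrite mule_ge0.
apply: ae_ge0_le_integral => //.
- apply: measurable_funeneg; apply/measurable_EFinP; apply: measurable_funM => //.
  apply: measurable_funB.
    by apply: measurable_funB; apply: measurableT_comp => //;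
      exact: measurable_fun_det.
  apply: measurable_funM; first exact/measurable_fun_sg/measurable_fun_det.
  by apply: measurable_fun_frob_dot => // i j; exact: measurable_fun_cof.
- by move=> x _; rewrite !mule_ge0// lee_fin frob_dot_ge0.
- exact: emeasurable_funM.
near=> x => Omx.
have q0 : 0 <= q x by move: Omx; near: x.
have sx : sigma <= smallest_singular_value (DZ0 x) by move: Omx; near: x.
have qN : (`|q x * \det (DZ0 x)|%:E <= N)%E.
  have : (`|((fun x => q x * \det (DZ0 x)) \_ Om) x|%:E <= N)%E.
    by near: x; exact: NP.
  by rewrite patchE mem_set.
rewrite funenegE ge_max; apply/andP; split; last first.
  by rewrite !mule_ge0// lee_fin frob_dot_ge0.
(* The pointwise value of [q * \det DZ0] stands between the integrand and the bound with its sup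
   norm [N]. *)
apply: (@le_trans _ _ ((c / (2 * sigma ^+ 2))%:E *
    `|q x * \det (DZ0 x)|%:E * (h x)%:E)%E); last first.
  by rewrite lee_wpmul2r ?lee_fin ?frob_dot_ge0// lee_wpmul2l.
rewrite -EFinN lee_fin -mulrN normrM (ger0_norm q0).
apply: le_trans (ler_wpM2l q0 (det_linearization_bound _ hd sigma_gt0 sx)) _.
rewrite [leLHS](_ : _ =
    5 / 2 / sigma ^+ 2 * (q x * `|\det (DZ0 x)|) * h x); last by rewrite /h; ring.
rewrite !ler_wpM2r ?mulr_ge0 ?frob_dot_ge0//.
by rewrite [(2 * _)^-1]invfM [leRHS]mulrA !ler_wpM2r ?invr_ge0 ?sqr_ge0.
Unshelve. all: by end_near.
Qed.
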